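(* Let $d\geq 3$ and $n\geq 4$. The possible numbers of singular points of a homogeneous polynomial of degree $d$ in $n$ variables with rank at most $n$ are exactly as follows. (a) If the rank is at most $n-2$, the number of singular points is infinite (and this occurs). (b) If the rank is $n-1$, the number of singular points is either $1$ or infinite, and both possibilities occur. (c) If the rank is $n$, the number of singular points is $0$, $1$, or infinite, and all three possibilities occur. In particular, no such polynomial of rank at most $n$ has exactly $k$ singular points with $1<k<\infty$.
   Context: Polynomials are nonzero, homogeneous, with complex coefficients, in variables $x_1,\ldots,x_n$. A point $p\in\mathbb{P}^{n-1}=\mathbb{P}^{n-1}_{\mathbb{C}}$ is a singular point of $f$ if all partial derivatives of $f$ vanish at $p$. The rank of $f$ of degree $d$ is the smallest $r$ such that $f=l_1^d+\cdots+l_r^d$ with $l_i$ complex linear forms in $x_1,\ldots,x_n$. *)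

(* Defs.v *)
From mathcomp Require Import all_boot all_order all_algebra.
From mathcomp Require Import classical_sets cardinality reals.
From mathcomp Require Import complex mpoly.

Set Implicit Arguments.
Unset Strict Implicit.
Unset Printing Implicit Defensive.

Import GRing.Theory.
Local Open Scope ring_scope.
Local Open Scope classical_set_scope.

(* Points are the lines through the origin. Two vspaces with the same elements
   are equal, so [=] is equality of projective points. *)
Definition proj_point (K : fieldType) (n : nat) : Type :=
  {L : {vspace 'rV[K]_n} | \dim L == 1%N}.

Definition vanishes_at (K : fieldType) (n : nat) (g : {mpoly K[n]})
    (p : proj_point K n) : Prop :=
  forall v : 'rV[K]_n, v \in val p -> v != 0 -> g.@[v ord0] = 0.

Definition singular_points (K : fieldType) (n : nat) (f : {mpoly K[n]}) :
    set (proj_point K n) :=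
  [set p | forall i : 'I_n, vanishes_at f^`M(i) p].

(* [0 \is d.-homog] holds in the library. *)
Definition is_form (K : fieldType) (n d : nat) (f : {mpoly K[n]}) : Prop :=
  f != 0 /\ f \is d.-homog.

Definition sum_of_powers (K : fieldType) (n d r : nat) (f : {mpoly K[n]}) :
    Prop :=
  exists l : 'I_r -> {mpoly K[n]},
    (forall i, l i \is 1.-homog) /\ f = \sum_(i < r) l i ^+ d.

Definition has_rank (K : fieldType) (n d : nat) (f : {mpoly K[n]}) (r : nat) :
    Prop :=
  sum_of_powers d r f /\ (forall s, sum_of_powers d s f -> (r <= s)%N).

Definition has_rank_at_most (K : fieldType) (n d : nat) (f : {mpoly K[n]})
    (m : nat) : Prop :=
  exists2 r : nat, (r <= m)%N & has_rank d f r.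

(* Main.v *)
Require Import Defs.
From mathcomp Require Import all_boot all_order all_algebra.
From mathcomp Require Import classical_sets boolp cardinality reals.
From mathcomp Require Import complex mpoly zify ring.

Set Implicit Arguments.
Unset Strict Implicit.
Unset Printing Implicit Defensive.

Import Order.TTheory GRing.Theory Num.Theory.
Local Open Scope ring_scope.
Local Open Scope classical_set_scope.
Local Open Scope card_scope.

(** Let f be the sum of the d-th powers of r <= n linear forms, the columns of
    an n x r matrix L, so that the values of the forms at v are y = v L. Up to
    a nonzero constant the gradient of f at v is y^(d-1) L^T, powers being
    taken entrywise. It depends on v only through v L, so the affine cone over
    the singular locus is stable under translation by the left kernel of L,
    and it contains that kernel. Hence, if the kernel contains w <> 0, either
    the line of w is the only singular point, or some singular v lies off that
    line and the lines of v + k w, for k a natural number, are infinitely many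
    singular points ([singular_points_of_ker]). If the kernel is zero, then
    r = n, L is invertible and there is no singular point. The kernel has
    dimension at least n - r: this gives all the restrictions on the number of
    singular points.

    Apart from x_0^d, the examples are forms in the first m of n variables,
    that is, of coefficient matrix Q M with Q the inclusion [pid_mx m] of
    coordinates. The sum of the d-th powers of m variables has rank m for
    m = n - 1 and m = n because a smaller rank would force more singular
    points. The others are sums of m + 1 powers which are not sums of m. If
    such a form were a sum of m powers, then in the m relevant variables its
    gradient and Hessian would be those of a square matrix Z
    ([exists_square_same_grad_hess]), and Z is invertible as soon as one
    Hessian is. Two obstructions follow.

    - A form of invertible Z is smooth. The form
      (x_0 + x_1)^d - 2^(d-1) (x_0^d + x_1^d) + x_2^d + ... + x_(m-1)^d is
      singular at (1, 1, 0, ..., 0), so it has rank m + 1; seen in more than m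
      variables it has infinitely many singular points
      ([exists_singular_hess_unit]).

    - The Hessians Z D_v Z^T, with D_v diagonal, make H_a H_w^-1 H_b symmetric
      ([hess_mul_inv_hess_sym]). This fails for the smooth form
      x_0^d + ... + x_(m-1)^d + ((x_0 + x_1 + x_2) / 4)^d, which therefore has
      rank m + 1; seen in m + 1 variables it has one singular point
      ([exists_smooth_not_sum_of_powers]). *)

(** * Gradient and Hessian of a sum of powers *)

Section PowerSums.
Variable K : numFieldType.

Definition linear_form n (a : 'cV[K]_n) : {mpoly K[n]} :=
  \sum_(i < n) a i 0 *: 'X_i.

Definition power_sum n r (d : nat) (L : 'M[K]_(n, r)) : {mpoly K[n]} :=
  \sum_(j < r) linear_form (col j L) ^+ d.

Definition map_exp n k (y : 'rV[K]_n) : 'rV[K]_n := map_mx (fun x => x ^+ k) y.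

(** [grad] and [hess] are the gradient and the Hessian of [power_sum d L]
    without their constant factors d and d (d - 1); see [mderiv_power_sum] and
    [mderiv2_power_sum]. *)
Definition grad n r d (L : 'M[K]_(n, r)) (v : 'rV[K]_n) : 'rV[K]_n :=
  map_exp d.-1 (v *m L) *m L^T.

Definition hess n r d (L : 'M[K]_(n, r)) (v : 'rV[K]_n) : 'M[K]_n :=
  L *m diag_mx (map_exp d.-2 (v *m L)) *m L^T.

Lemma linear_form_homog n (a : 'cV[K]_n) : linear_form a \is 1.-homog.
Proof. by apply: rpred_sum => i _; rewrite rpredZ // dhomogX /= mdeg1. Qed.

Lemma homog1_linear_form n (l : {mpoly K[n]}) :
  l \is 1.-homog -> l = linear_form (\col_i l@_U_(i)).
Proof.
move=> /dhomogP hl; apply/mpolyP => m; rewrite /linear_form linear_sum /=.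
have [/mdeg1P[i /eqP ->] | hm] := boolP (mdeg m == 1%N).
  rewrite (bigD1 i) //= mcoeffZ mcoeffX eqxx mulr1 mxE big1 ?addr0 // => j ji.
  by rewrite mcoeffZ mcoeffX eq_mnm1 (negPf ji) mulr0.
rewrite big1 => [|i _].
  by apply/eqP; rewrite mcoeff_eq0; apply: contra hm => /hl ->.
rewrite mcoeffZ mcoeffX; case: eqP => [e|]; rewrite ?mulr0 //.
by rewrite -e mdeg1 in hm.
Qed.

Lemma sum_of_powersP n d r (f : {mpoly K[n]}) :
  sum_of_powers d r f <-> exists L : 'M[K]_(n, r), f = power_sum d L.
Proof.
split=> [[l [hl ->]]|[L ->]]; last first.
  by exists (fun j => linear_form (col j L)); split=> // j;
     apply: linear_form_homog.
exists (\matrix_(i, j) (l j)@_U_(i)); apply: eq_bigr => j _; congr (_ ^+ _).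
rewrite [LHS]homog1_linear_form //; congr linear_form.
by apply/colP => i; rewrite !mxE.
Qed.

Lemma meval_linear_form n r (L : 'M[K]_(n, r)) j (v : 'rV[K]_n) :
  (linear_form (col j L)).@[v ord0] = (v *m L) 0 j.
Proof.
rewrite raddf_sum mxE; apply: eq_bigr => i _ /=.
by rewrite mevalZ mevalXU mxE mulrC.
Qed.

Lemma mderiv_linear_form_exp n (a : 'cV[K]_n) k i :
  (linear_form a ^+ k)^`M(i) = (k%:R * a i 0) *: linear_form a ^+ k.-1.
Proof.
have D1 : (linear_form a)^`M(i) = (a i 0)%:MP.
  rewrite linear_sum (bigD1 i) //= mderivZ mderivX mnm1E eqxx scale1r.
  have ->: (U_(i) - U_(i) = 0)%MM by apply/mnmP => p; rewrite mnmBE mnm0E subnn.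
  rewrite mpolyX0 big1 => [|j ji]; first by rewrite addr0 alg_mpolyC.
  by rewrite mderivZ mderivX mnm1E (negPf ji) scale0r scaler0.
elim: k => [|k IH]; first by rewrite expr0 -mpolyC1 mderivC mul0r scale0r.
rewrite exprS mderivM IH D1 mul_mpolyC -scalerAr.
case: k {IH} => [|k]; first by rewrite mul0r scale0r addr0 mul1r.
by rewrite -exprS -scalerDl -{1}[a i 0]mul1r -mulrDl -mulrS.
Qed.

Lemma mderiv_power_sum n r d (L : 'M[K]_(n, r)) i (v : 'rV[K]_n) :
  (power_sum d L)^`M(i).@[v ord0] = d%:R * grad d L v 0 i.
Proof.
rewrite (linear_sum (mderiv i)) raddf_sum [in RHS]mxE mulr_sumr.
apply: eq_bigr => j _ /=.
rewrite mderiv_linear_form_exp mevalZ rmorphXn /= meval_linear_form -mulrA.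
by rewrite !mxE [X in _ = _ * X]mulrC.
Qed.

Lemma mderiv2_power_sum n r d (L : 'M[K]_(n, r)) i k (v : 'rV[K]_n) :
  ((power_sum d L)^`M(i))^`M(k).@[v ord0]
  = (d * d.-1)%:R * hess d L v i k.
Proof.
rewrite (linear_sum (mderiv i)) (linear_sum (mderiv k)) raddf_sum [in RHS]mxE.
rewrite mulr_sumr; apply: eq_bigr => j _ /=.
rewrite mderiv_linear_form_exp mderivZ mderiv_linear_form_exp !mevalZ.
rewrite rmorphXn /= meval_linear_form mul_mx_diag natrM.
rewrite !mxE -!mulrA; congr (_ * _); rewrite mulrCA; congr (_ * _).
by rewrite [X in _ = _ * X]mulrC.
Qed.

(** A form may be a sum of powers in several ways. In characteristic zero the
    gradient and the Hessian computed from the linear forms depend on the form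
    only, which makes them usable as invariants of the rank. *)
Lemma eq_grad n r s d (L : 'M[K]_(n, r)) (M : 'M[K]_(n, s)) :
  (0 < d)%N -> power_sum d L = power_sum d M -> grad d L =1 grad d M.
Proof.
move=> d0 eqLM v; apply/rowP => i.
have := mderiv_power_sum d L i v; rewrite eqLM mderiv_power_sum.
by move/mulfI => -> //; rewrite pnatr_eq0 -lt0n.
Qed.

Lemma eq_hess n r s d (L : 'M[K]_(n, r)) (M : 'M[K]_(n, s)) :
  (1 < d)%N -> power_sum d L = power_sum d M -> hess d L =1 hess d M.
Proof.
move=> d1 eqLM v; apply/matrixP => i k.
have := mderiv2_power_sum d L i k v; rewrite eqLM mderiv2_power_sum.
move/mulfI => -> //; rewrite pnatr_eq0 -lt0n muln_gt0.
by case: d d1 {eqLM} => [|[]].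
Qed.

Lemma grad_mul n m r d (P : 'M[K]_(m, n)) (L : 'M[K]_(n, r)) v :
  grad d (P *m L) v = grad d L (v *m P) *m P^T.
Proof. by rewrite /grad trmx_mul !mulmxA. Qed.

Lemma hess_mul n m r d (P : 'M[K]_(m, n)) (L : 'M[K]_(n, r)) v :
  hess d (P *m L) v = P *m hess d L (v *m P) *m P^T.
Proof. by rewrite /hess trmx_mul !mulmxA. Qed.

Lemma gradZ n r d (L : 'M[K]_(n, r)) a v :
  grad d L (a *: v) = a ^+ d.-1 *: grad d L v.
Proof.
rewrite /grad -scalemxAl; apply/rowP => i; rewrite !mxE mulr_sumr.
by apply: eq_bigr => j _; rewrite !mxE exprMn mulrA.
Qed.

Lemma grad_eq0_of_ker n r d (L : 'M[K]_(n, r)) v :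
  (1 < d)%N -> v *m L = 0 -> grad d L v = 0.
Proof.
move=> d1 vL; rewrite /grad vL; suff -> : map_exp d.-1 (0 : 'rV[K]_r) = 0.
  by rewrite mul0mx.
by apply/rowP => j; rewrite !mxE expr0n; case: d d1 => [|[]].
Qed.

Lemma grad_add_ker n r d (L : 'M[K]_(n, r)) v w :
  w *m L = 0 -> grad d L (v + w) = grad d L v.
Proof. by move=> wL; rewrite /grad mulmxDl wL addr0. Qed.

(** The gradient is a linear combination, with the (d-1)-st powers of the
    values as coefficients, of the forms; independent forms must all
    vanish at a singular point. *)
Lemma ker_of_grad_eq0 n r d (L : 'M[K]_(n, r)) v :
  \rank L = r -> grad d L v = 0 -> v *m L = 0.
Proof.
move=> rL /eqP; rewrite mulmx_free_eq0 ?/row_free ?mxrank_tr ?rL //.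
move=> /eqP /rowP h; apply/rowP => j; move/eqP: (h j).
by rewrite !mxE expf_eq0 => /andP[_ /eqP].
Qed.

(** * Projective points as lines *)

Lemma dim_line_eq1 n (v : 'rV[K]_n) : v != 0 -> \dim <[v]>%VS == 1%N.
Proof. by rewrite dim_vline => ->. Qed.

Definition line_point n (v : 'rV[K]_n) (v0 : v != 0) : proj_point K n :=
  exist _ <[v]>%VS (dim_line_eq1 v0).

Lemma line_pointP n (p : proj_point K n) :
  exists v, exists v0 : v != 0, p = line_point v0.
Proof.
case: p => U dU; have U0 : U != 0%VS by rewrite -dimv_eq0 (eqP dU).
have v0 : vpick U != 0 by rewrite vpick0.
exists (vpick U), v0; apply/val_inj => /=; apply/esym/eqP.
by rewrite eqEdim -memvE memv_pick dim_vline v0 (eqP dU).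
Qed.

Lemma eq_line_point n (v w : 'rV[K]_n) (v0 : v != 0) (w0 : w != 0) :
  line_point v0 = line_point w0 <-> exists a, v = a *: w.
Proof.
split=> [/(congr1 val) /= vw|[a vaw]].
  by apply/vlineP; rewrite -vw memv_line.
apply/val_inj => /=; apply/eqP; rewrite eqEdim !dim_vline v0 w0 andbT -memvE.
by apply/vlineP; exists a.
Qed.

Lemma singular_line_point n r d (L : 'M[K]_(n, r)) v (v0 : v != 0) :
  (0 < d)%N ->
  singular_points (power_sum d L) (line_point v0) <-> grad d L v = 0.
Proof.
move=> d0; split=> [h|h i w /= /vlineP[a ->] _]; last first.
  by rewrite mderiv_power_sum gradZ h scaler0 mxE mulr0.
apply/rowP => i; have /eqP := h i v (memv_line v) v0.
rewrite mderiv_power_sum mulf_eq0 pnatr_eq0 eqn0Ngt d0 /=.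
by rewrite [in RHS]mxE => /eqP.
Qed.

(** * Singular points and the kernel of the linear forms *)

(** The gradient is constant along v + K w, and the lines of v + k w for
    natural numbers k are pairwise distinct. *)
Lemma infinite_singular_points n r d (L : 'M[K]_(n, r)) v w :
  (0 < d)%N -> w != 0 -> w *m L = 0 -> grad d L v = 0 ->
  (forall a, v != a *: w) -> infinite_set (singular_points (power_sum d L)).
Proof.
move=> d0 w0 wL gv vw.
have vk0 (k : nat) : v + k%:R *: w != 0.
  by rewrite addr_eq0 -scaleNr.
pose f k := line_point (vk0 k).
have f_inj : injective f.
  move=> k l /eq_line_point[a eq_a]; apply/eqP.
  have {}eq_a : (1 - a) *: v = (a * l%:R - k%:R) *: w.
    rewrite !scalerBl scale1r; apply/eqP; rewrite subr_eq addrAC eq_sym subr_eq.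
    by rewrite eq_a scalerDr scalerA addrC.
  have [a1|a1] := eqVneq (1 - a) 0.
    move/eqP: eq_a; rewrite a1 scale0r eq_sym scaler_eq0 (negPf w0) orbF.
    move/eqP: a1; rewrite subr_eq0 => /eqP <-.
    by rewrite mul1r subr_eq0 eqr_nat eq_sym.
  have /eqP[] := vw ((1 - a)^-1 * (a * l%:R - k%:R)).
  by rewrite -scalerA -eq_a scalerA mulVf // scale1r.
apply: (@sub_infinite_set _ (range f)).
  move=> _ [k _ <-]; apply/singular_line_point => //.
  by rewrite grad_add_ker // -scalemxAl wL scaler0.
apply/infiniteP; rewrite (card_le_eqr (inj_card_eq (in2W f_inj))).
exact: card_lexx.
Qed.

Lemma singular_points_of_ker n r d (L : 'M[K]_(n, r)) w (w0 : w != 0) :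
  (1 < d)%N -> w *m L = 0 ->
  singular_points (power_sum d L) = [set line_point w0] \/
  infinite_set (singular_points (power_sum d L)).
Proof.
move=> d1 wL; have d0 := ltnW d1.
have [[v gv vw]|no] :=
  pselect (exists2 v, grad d L v = 0 & forall a, v != a *: w).
  by right; apply: infinite_singular_points gv vw.
left; apply/seteqP; split=> [p|_ ->]; last first.
  by apply/singular_line_point => //; apply: grad_eq0_of_ker.
have [v [v0 ->]] := line_pointP p.
move=> /singular_line_point -/(_ d0) gv; apply/eq_line_point.
apply: contra_notP no => no; exists v => // a.
by apply/eqP => va; apply: no; exists a.
Qed.

Lemma singular_points_full_rank n r d (L : 'M[K]_(n, r)) :
  (0 < d)%N -> \rank L = r -> (forall v : 'rV_n, v *m L = 0 -> v = 0) ->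
  singular_points (power_sum d L) = set0.
Proof.
move=> d0 rL kerL; apply/seteqP; split=> // p.
have [v [v0 ->]] := line_pointP p => /singular_line_point -/(_ d0).
by move=> /(ker_of_grad_eq0 rL)/kerL ve; case: (negP v0); rewrite ve.
Qed.

Lemma exists_ker n r (L : 'M[K]_(n, r)) :
  (r < n)%N -> exists2 w : 'rV_n, w != 0 & w *m L = 0.
Proof.
move=> rn; have : kermx L != 0.
  by rewrite kermx_eq0 /row_free neq_ltn (leq_ltn_trans (rank_leq_col L)).
by case/rowV0Pn => w /sub_kermxP wL w0; exists w.
Qed.

(** The kernel has dimension at least 2, hence contains a second line. *)
Lemma infinite_singular_points_corank2 n r d (L : 'M[K]_(n, r)) :
  (1 < d)%N -> (r.+1 < n)%N -> infinite_set (singular_points (power_sum d L)).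
Proof.
move=> d1 rn; have [w w0 wL] := exists_ker L (ltnW rn).
have : ~~ (kermx L <= w)%MS.
  apply/negP => /mxrankS; rewrite mxrank_ker rank_rV w0 leqNgt.
  by have := rank_leq_col L; lia.
case/row_subPn => i /negP iw.
apply: (infinite_singular_points (ltnW d1) w0 wL (v := row i (kermx L))).
  by apply: grad_eq0_of_ker => //; apply/sub_kermxP/row_sub.
by move=> a; apply/eqP => e; apply: iw; rewrite e scalemx_sub.
Qed.

Lemma singular_points_trichotomy n r d (L : 'M[K]_(n, r)) :
  (1 < d)%N -> (r <= n)%N ->
  [\/ singular_points (power_sum d L) = set0,
      exists p, singular_points (power_sum d L) = [set p] |
      infinite_set (singular_points (power_sum d L))].
Proof.
move=> d1 rn; have [fr|] := boolP (row_free L).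
  have rL : \rank L = r.
    by apply/eqP; rewrite eqn_leq rank_leq_col (eqP fr).
  constructor 1; apply: singular_points_full_rank (ltnW d1) rL _ => v.
  by move/eqP; rewrite mulmx_free_eq0 // => /eqP.
rewrite -kermx_eq0 => /rowV0Pn[w /sub_kermxP wL w0].
have [->|] := singular_points_of_ker w0 d1 wL; last by constructor 3.
by constructor 2; exists (line_point w0).
Qed.

(** * Forms in fewer variables *)

Lemma pid_mx_retract m n : (m <= n)%N ->
  (pid_mx m : 'M[K]_(m, n)) *m (pid_mx m : 'M[K]_(n, m)) = 1%:M.
Proof. by move=> mn; rewrite mul_pid_mx minnn (minn_idPr mn) pid_mx_1. Qed.

Lemma grad_pid_mx n m r d (M : 'M[K]_(m, r)) (v : 'rV[K]_n) : (m <= n)%N ->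
  grad d (pid_mx m *m M) v = 0 <-> grad d M (v *m pid_mx m) = 0.
Proof.
move=> mn; rewrite grad_mul tr_pid_mx; split=> [h|->]; last exact: mul0mx.
by rewrite -[LHS]mulmx1 -(pid_mx_retract mn) mulmxA h mul0mx.
Qed.

(** A smooth form in m variables, seen in one more variable, defines a cone: its
    vertex is the only singular point. *)
Lemma singular_points_cone n m r d (M : 'M[K]_(m, r)) :
  n = m.+1 -> (1 < d)%N -> (forall x, grad d M x = 0 -> x = 0) ->
  exists p : proj_point K n,
    singular_points (power_sum d (pid_mx m *m M)) = [set p].
Proof.
move=> -> d1 smooth; have d0 := ltnW d1.
pose Q : 'M[K]_(m.+1, m) := pid_mx m.
have [w w0 wQ] := exists_ker Q (ltnSn m).
exists (line_point w0); apply/seteqP; split=> [p|_ ->]; last first.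
  apply/singular_line_point => //; apply: grad_eq0_of_ker => //.
  by rewrite mulmxA wQ mul0mx.
have [v [v0 ->]] := line_pointP p => /singular_line_point -/(_ d0).
move/grad_pid_mx => /(_ (leqnSn m)) /smooth vQ.
apply/eq_line_point; apply/sub_rVP.
(* The kernel of Q is a line, so w spans it. *)
have wker : (w <= kermx Q)%MS by apply/sub_kermxP.
have /eqmxP/eqmx_sym weq : (w == kermx Q)%MS.
  rewrite -(mxrank_leqif_eq wker) rank_rV w0 mxrank_ker rank_pid_mx //.
  by rewrite subSnn.
by rewrite -weq; apply/sub_kermxP.
Qed.

Lemma singular_points_singular_cone n m r d (M : 'M[K]_(m, r)) x :
  (1 < d)%N -> (m < n)%N -> x != 0 -> grad d M x = 0 ->
  infinite_set
    (singular_points (power_sum d ((pid_mx m : 'M[K]_(n, m)) *m M))).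
Proof.
move=> d1 mn x0 gx; have [w w0 wQ] := exists_ker (pid_mx m : 'M[K]_(n, m)) mn.
have xPQ : x *m pid_mx m *m (pid_mx m : 'M[K]_(n, m)) = x.
  by rewrite -mulmxA pid_mx_retract ?mulmx1 // ltnW.
apply: (infinite_singular_points (ltnW d1) w0 (v := x *m pid_mx m)).
- by rewrite mulmxA wQ mul0mx.
- by apply: (proj2 (grad_pid_mx d M _ (ltnW mn))); rewrite xPQ.
- move=> a; apply/eqP => e; move/eqP: x0; apply.
  by rewrite -xPQ e -scalemxAl wQ scaler0.
Qed.

(** * Obstructions to being a sum of m powers in m variables *)

(** Dropping the last n - m coordinates of the linear forms of a second
    decomposition leaves a square matrix, with the same derivatives at the
    points of the m-dimensional coordinate subspace. *)
Lemma exists_square_same_grad_hess n m r d (M : 'M[K]_(m, r)) :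
  (1 < d)%N -> (m <= n)%N ->
  sum_of_powers d m (power_sum d ((pid_mx m : 'M[K]_(n, m)) *m M)) ->
  exists Z : 'M[K]_m, grad d M =1 grad d Z /\ hess d M =1 hess d Z.
Proof.
move=> d1 mn /sum_of_powersP[L eqL]; exists (pid_mx m *m L).
have PQM : M = pid_mx m *m ((pid_mx m : 'M[K]_(n, m)) *m M).
  by rewrite mulmxA pid_mx_retract // mul1mx.
split=> x; rewrite [in LHS]PQM.
  by rewrite (grad_mul _ _ (_ *m M)) (eq_grad (ltnW d1) eqL) -grad_mul.
by rewrite (hess_mul _ _ (_ *m M)) (eq_hess d1 eqL) -hess_mul.
Qed.

Lemma unitmx_of_hess m d (Z : 'M[K]_m) w : hess d Z w \in unitmx ->
  Z \in unitmx.
Proof. by rewrite /hess !unitmx_mul => /andP[/andP[]]. Qed.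

(** One invertible Hessian forces the m forms to be independent, hence the
    form to be smooth in its m variables. *)
Lemma not_sum_of_powers_singular n m r d (M : 'M[K]_(m, r)) w x :
  (1 < d)%N -> (m <= n)%N -> hess d M w \in unitmx ->
  x != 0 -> grad d M x = 0 ->
  ~ sum_of_powers d m (power_sum d ((pid_mx m : 'M[K]_(n, m)) *m M)).
Proof.
move=> d1 mn Hw x0 gx /(exists_square_same_grad_hess d1 mn)[Z [gZ hZ]].
have Zu : Z \in unitmx by move: Hw; rewrite hZ; apply: unitmx_of_hess.
move: gx; rewrite gZ => /ker_of_grad_eq0; rewrite mxrank_unit // => /(_ erefl).
by move/eqP; rewrite mulmx_free_eq0 ?row_free_unit // (negPf x0).
Qed.

(** Writing H_v = Z D_v Z^T with Z invertible,
    H_a H_w^-1 H_b = Z D_a D_w^-1 D_b Z^T, and diagonal matrices commute. *)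
Lemma hess_mul_inv_hess_sym m d (Z : 'M[K]_m) a w b : hess d Z w \in unitmx ->
  let X := hess d Z a *m invmx (hess d Z w) *m hess d Z b in X^T = X.
Proof.
move=> Hw; rewrite /hess in Hw *.
set Dw := diag_mx (map_exp d.-2 (w *m Z)) in Hw *.
set G := invmx _; set a' := map_exp _ (a *m Z); set b' := map_exp _ (b *m Z).
have Zu := unitmx_of_hess Hw.
(* E is the inverse of Dw, so it is symmetric and commutes with diagonals. *)
pose E := Z^T *m G *m Z.
have DE : Dw *m E = 1%:M.
  by rewrite /E !mulmxA; apply: mulmx1C; rewrite !mulmxA; apply: mulmxV Hw.
have ED : E *m Dw = 1%:M by apply: mulmx1C.
have ET : E^T = E.
  by rewrite -[LHS]mulmx1 -DE mulmxA -[Dw]tr_diag_mx -trmx_mul DE trmx1 mul1mx.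
have comm_E (c : 'rV[K]_m) : E *m diag_mx c = diag_mx c *m E.
  rewrite -[LHS]mulmx1 -DE !mulmxA -(mulmxA E) (diag_mxC c).
  by rewrite !mulmxA ED mul1mx.
have eX : Z *m diag_mx a' *m Z^T *m G *m (Z *m diag_mx b' *m Z^T)
   = Z *m (diag_mx a' *m E *m diag_mx b') *m Z^T by rewrite /E !mulmxA.
clearbody E; rewrite /= eX !trmx_mul trmxK ET !tr_diag_mx -!mulmxA.
congr (_ *m _); rewrite !mulmxA; congr (_ *m _).
by rewrite -comm_E -!mulmxA diag_mxC !mulmxA comm_E.
Qed.

(** * A diagonal form plus one power *)

(** Its power sum is (b_0 x_0)^d + ... + (b_(m-1) x_(m-1))^d + u^d. *)
Definition diag_sum m (b : 'rV[K]_m) (u : 'cV[K]_m) : 'M[K]_(m, m + 1) :=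
  row_mx (diag_mx b) u.

Lemma grad_diag_sum m d (b : 'rV[K]_m) (u : 'cV[K]_m) x i :
  grad d (diag_sum b u) x 0 i
  = (x 0 i * b 0 i) ^+ d.-1 * b 0 i + (x *m u) 0 0 ^+ d.-1 * u i 0.
Proof.
rewrite /grad mul_mx_row /map_exp map_row_mx tr_row_mx mul_row_col tr_diag_mx.
rewrite !mul_mx_diag mxE; congr (_ + _); first by rewrite !mxE.
by rewrite [LHS]mxE big_ord1 !mxE.
Qed.

Lemma hess_diag_sum m d (b : 'rV[K]_m) (u : 'cV[K]_m) x :
  hess d (diag_sum b u) x
  = diag_mx (\row_i ((x 0 i * b 0 i) ^+ d.-2 * b 0 i ^+ 2))
    + (x *m u) 0 0 ^+ d.-2 *: (u *m u^T).
Proof.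
rewrite /hess mul_mx_row /map_exp map_row_mx diag_mx_row mul_row_block.
rewrite !mulmx0 addr0 add0r tr_row_mx mul_row_col tr_diag_mx !mul_mx_diag.
apply/matrixP => i j; rewrite mxE [RHS]mxE; congr (_ + _).
  rewrite !mxE; have [<-|ij] := eqVneq i j; last by rewrite !mulr0n !mul0r.
  by rewrite !mulr1n mulrAC -expr2 mulrC.
by rewrite [RHS]mxE [X in _ = _ * X]mxE mxE !big_ord1 !mxE mulrAC mulrC mulrA.
Qed.

(** Let t be the value of u at a singular point x. Then
    x_i^(d-1) = - u_i t^(d-1), so |x_i| <= |t|, and
    |t| <= (\sum_i |u_i|) |t| forces t = 0. *)
Lemma smooth_diag_sum m d (u : 'cV[K]_m) :
  (1 < d)%N -> (forall i, `|u i 0| <= 1) -> \sum_i `|u i 0| < 1 ->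
  forall x, grad d (diag_sum (const_mx 1) u) x = 0 -> x = 0.
Proof.
move=> d1 u1 su x gx; set t := (x *m u) 0 0.
have d'0 : (0 < d.-1)%N by lia.
have xi i : x 0 i ^+ d.-1 = - (t ^+ d.-1 * u i 0).
  have := congr1 (fun g : 'rV_m => g 0 i) gx.
  rewrite grad_diag_sum -/t [const_mx _ _ _]mxE [in RHS]mxE !mulr1 => /eqP.
  by rewrite addr_eq0 => /eqP.
have le_xt i : `|x 0 i| <= `|t|.
  rewrite -(ler_pXn2r d'0) ?nnegrE // -!normrX xi normrN normrM normrX.
  by rewrite ler_piMr ?exprn_ge0.
have t0 : t = 0.
  apply/eqP; apply: contraTT su => t0.
  rewrite -real_leNgt ?realE ?ler01 //; last by rewrite sumr_ge0.
  rewrite -(ler_pM2l (x := `|t|)) ?normr_gt0 // mulr1 mulr_sumr.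
  rewrite {1}/t mxE; apply: le_trans (ler_norm_sum _ _ _) _.
  by apply: ler_sum => i _; rewrite normrM ler_wpM2r.
apply/rowP => i; apply/eqP; rewrite mxE -normr_le0 (le_trans (le_xt i)) //.
by rewrite t0 normr0.
Qed.

Lemma unitmx_diag m (b : 'rV[K]_m) :
  (diag_mx b \in unitmx) = [forall i, b 0 i != 0].
Proof.
rewrite unitmxE det_diag unitfE; apply/prodf_neq0/forallP => h i.
  exact: h.
by move=> _; apply: h.
Qed.

(** The form is x_0^d + ... + x_(m-1)^d + u^d with
    u = (x_0 + x_1 + x_2) / 4, the factor 1 / 4 making it smooth. With
    w = (1, 1, -2, 1, ..., 1) on the hyperplane u = 0, the Hessian H_w is
    diagonal and invertible, while H_(e_0) and H_(e_1) are E_00 + T and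
    E_11 + T, where the symmetric matrix T is a nonzero multiple of u u^T. The
    entries (0, 2) and (2, 0) of H_(e_0) H_w^-1 H_(e_1) differ by the entry
    (0, 2) of E_00 H_w^-1 T, which is not zero. *)
Lemma exists_smooth_not_sum_of_powers m d : (2 < m)%N -> (2 < d)%N ->
  exists M : 'M[K]_(m, m + 1), (forall x, grad d M x = 0 -> x = 0) /\
    forall n, (m <= n)%N ->
    ~ sum_of_powers d m (power_sum d ((pid_mx m : 'M[K]_(n, m)) *m M)).
Proof.
case: m => [|[|[|m]]] // _ d2; have d1 := ltnW d2.
have d2' : (d.-2 == 0)%N = false by case: d d2 {d1} => [|[|[|]]].
pose u : 'cV[K]_m.+3 := \col_i if (i < 3)%N then 4^-1 else 0.
pose i0 : 'I_m.+3 := ord0; pose i1 : 'I_m.+3 := lift ord0 ord0.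
pose i2 : 'I_m.+3 := lift ord0 (lift ord0 ord0).
have sum3 (F : 'I_m.+3 -> K) :
    (forall i : 'I_m.+3, (2 < i)%N -> F i = 0) ->
    \sum_i F i = F i0 + F i1 + F i2.
  move=> F0; rewrite !big_ord_recl big1 => [|i _]; last by rewrite F0.
  by rewrite addr0 !addrA.
have u_gt2 (i : 'I_m.+3) : (2 < i)%N -> u i 0 = 0.
  by move=> i2'; rewrite mxE ltnNge i2'.
exists (diag_sum (const_mx 1) u); split=> [x|n mn].
  apply: smooth_diag_sum => // [i|].
    rewrite mxE; case: ifP => _; last by rewrite normr0.
    by rewrite ger0_norm ?invr_ge0 ?invf_le1 ?ler1n.
  rewrite sum3 => [|i /u_gt2 ->]; last by rewrite normr0.
  rewrite !mxE /= ger0_norm ?invr_ge0 //.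
  by rewrite -mulr2n -mulrSr -[_ *+ 3]mulr_natl ltr_pdivrMr // mul1r ltr_nat.
case/(exists_square_same_grad_hess d1 mn) => Z [_ hZ].
pose w : 'rV[K]_m.+3 := \row_i if i == i2 then -2 else 1.
have wu : (w *m u) 0 0 = 0.
  rewrite mxE sum3 => [|i /u_gt2 ->]; last by rewrite mulr0.
  by rewrite !mxE /=; ring.
pose D := \row_i (w 0 i ^+ d.-2).
have D0 i : D 0 i != 0.
  rewrite !mxE expf_eq0 negb_and; apply/orP; right.
  by case: (i == i2); rewrite ?oppr_eq0 ?pnatr_eq0 ?oner_eq0.
have hw : hess d Z w = diag_mx D.
  rewrite -hZ hess_diag_sum wu expr0n d2' scale0r addr0; congr diag_mx.
  by apply/rowP => i; rewrite !mxE expr1n !mulr1.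
have iD : invmx (diag_mx D) = diag_mx (\row_i (D 0 i)^-1).
  rewrite -[LHS]mulmx1; set G := RHS.
  have DG : diag_mx D *m G = 1%:M.
    rewrite mulmx_diag -diag_const_mx; congr diag_mx.
    by apply/rowP => i; have := D0 i; rewrite !mxE => /mulfV.
  by rewrite -DG mulmxA mulVmx ?mul1mx // unitmx_diag; apply/forallP.
have Hw : hess d Z w \in unitmx by rewrite hw unitmx_diag; apply/forallP.
pose c : K := 4^-1 ^+ d.-2.
have hE (a i j : 'I_m.+3) : (a < 3)%N ->
  hess d Z (delta_mx 0 a) i j
  = ((i == j) && (i == a))%:R + c * (u i 0 * u j 0).
  move=> a3; rewrite -hZ hess_diag_sum -rowE [LHS]mxE [X in _ + X]mxE.
  have -> : row a u 0 0 = 4^-1 by rewrite !mxE a3.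
  congr (_ + _ * _); last by rewrite [LHS]mxE big_ord1 [u^T _ _]mxE.
  rewrite !mxE eqxx /= expr1n !mulr1; case: (i == a); last first.
    by rewrite andbF expr0n d2' mul0rn.
  by rewrite andbT expr1n.
have := hess_mul_inv_hess_sym (delta_mx 0 i0) (delta_mx 0 i1) Hw.
rewrite /= hw iD mul_mx_diag => /matrixP /(_ i0 i2).
rewrite [LHS]mxE [LHS]mxE [RHS]mxE.
(* F j is the j-th summand of the entry (0, 2), and of the entry (2, 0), of
   T H_w^-1 T. *)
pose F j := c * (4^-1 * u j 0) * (D 0 j)^-1 * (c * (u j 0 * 4^-1)).
have u0 : u i0 0 = 4^-1 by rewrite mxE.
have u2 : u i2 0 = 4^-1 by rewrite mxE.
rewrite (eq_bigr F) => [|j _]; last first.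
  rewrite [X in X * _]mxE !hE // [X in _ * X * _]mxE u0 u2 andbF add0r.
  by case: eqP => [->|_]; rewrite add0r.
rewrite [RHS](eq_bigr (fun j =>
    (j == i0)%:R * (D 0 j)^-1 * (c * (4^-1 * 4^-1)) + F j)) => [|j _];
    last first.
  rewrite [X in X * _]mxE !hE // [X in _ * X * _]mxE u0 u2 [i0 == j]eq_sym eqxx.
  rewrite andbT (_ : (j == i2) && (j == i1) = false); last first.
    by case: eqP => // ->.
  rewrite add0r !mulrDl; congr (_ + _).
  by case: eqP => [->|_]; rewrite ?u0 // !mul0r.
rewrite big_split /= -[LHS]add0r => /addIr/esym/eqP.
rewrite (bigD1 i0) //= big1 => [|j /negPf ->]; last by rewrite !mul0r.
rewrite mul1r addr0 !mulf_eq0 invr_eq0 (negPf (D0 i0)) expf_eq0 invr_eq0.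
by rewrite pnatr_eq0 !andbF.
Qed.

(** * Comparing ranks *)

Lemma sum_of_powers_power_sum n r d (L : 'M[K]_(n, r)) :
  sum_of_powers d r (power_sum d L).
Proof. by apply/sum_of_powersP; exists L. Qed.

Lemma sum_of_powers_leq n d r s (f : {mpoly K[n]}) :
  (0 < d)%N -> (r <= s)%N -> sum_of_powers d r f -> sum_of_powers d s f.
Proof.
move=> d0 rs /sum_of_powersP[L ->]; apply/sum_of_powersP.
rewrite -(subnKC rs); exists (row_mx L 0); rewrite /power_sum big_split_ord /=.
rewrite [X in _ = _ + X]big1 => [|j _]; last first.
  rewrite /linear_form big1 ?expr0n ?eqn0Ngt ?d0 // => i _.
  by rewrite mxE row_mxEr mxE scale0r.
rewrite addr0; apply: eq_bigr => j _; congr (linear_form _ ^+ _).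
by apply/colP => i; rewrite mxE [RHS]mxE row_mxEl.
Qed.

Lemma has_rankS n d r (f : {mpoly K[n]}) : (0 < d)%N ->
  sum_of_powers d r.+1 f -> ~ sum_of_powers d r f -> has_rank d f r.+1.
Proof.
move=> d0 fr nfr; split=> // s fs; rewrite ltnNge; apply/negP => sr.
by apply: nfr; apply: sum_of_powers_leq fs.
Qed.

Lemma has_rank_at_most_sum n d r (f : {mpoly K[n]}) :
  sum_of_powers d r f -> has_rank_at_most d f r.
Proof.
move=> fr; have ex : exists s, `[< sum_of_powers d s f >].
  by exists r; apply/asboolP.
have [m /asboolP fm min_m] := ex_minnP ex.
exists m; first by apply/min_m/asboolP.
by split=> // s fs; apply/min_m/asboolP.
Qed.

Lemma sum_of_powers_form n d r (f : {mpoly K[n]}) :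
  (0 < d)%N -> sum_of_powers d r f -> ~ sum_of_powers d 0 f -> is_form d f.
Proof.
move=> d0 [l [hl ->]] nf; split.
  apply/eqP => e; apply: nf; exists (fun=> 0).
  by split=> [i|]; [apply: dhomog0 | rewrite big_ord0].
apply: rpred_sum => j _.
by have := dhomogMn d (hl j); rewrite mul1n.
Qed.

End PowerSums.

(** * A singular form with an invertible Hessian *)

(** The form is (x_0 + x_1)^d - 2^(d-1) (x_0^d + x_1^d) + x_2^d + ... . Its part
    in x_0 and x_1 has a double root at (1, 1). The Hessian at
    w = (1, -1, 1, ..., 1) is diagonal because x_0 + x_1 vanishes there. *)
Lemma exists_singular_hess_unit (C : numClosedFieldType) m d :
  (1 < m)%N -> (2 < d)%N ->
  exists M : 'M[C]_(m, m + 1), (exists2 x, x != 0 & grad d M x = 0) /\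
    exists w, hess d M w \in unitmx.
Proof.
case: m => [|[|m]] // _ d2.
have d1' : (d.-1 == 0)%N = false by case: d d2 => [|[|[|]]].
have d2' : (d.-2 == 0)%N = false by case: d d2 {d1'} => [|[|[|]]].
pose be : C := d.-root (- 2 ^+ d.-1).
have beE : be ^+ d = - 2 ^+ d.-1 by rewrite rootCK //; lia.
have be0 : be != 0.
  apply/eqP => e; move/eqP: beE; rewrite e expr0n.
  have -> : (d == 0)%N = false by lia.
  by rewrite eq_sym oppr_eq0 expf_eq0 pnatr_eq0 andbF.
pose i0 : 'I_m.+2 := ord0; pose i1 : 'I_m.+2 := lift ord0 ord0.
pose b : 'rV[C]_m.+2 := \row_i if (i < 2)%N then be else 1.
pose u : 'cV[C]_m.+2 := \col_i (i < 2)%:R.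
pose x : 'rV[C]_m.+2 := \row_i (i < 2)%:R.
pose w : 'rV[C]_m.+2 := \row_i if i == i1 then -1 else 1.
have yu (y : 'rV[C]_m.+2) : (y *m u) 0 0 = y 0 i0 + y 0 i1.
  rewrite mxE !big_ord_recl big1 => [|i _]; last by rewrite !mxE mulr0.
  by rewrite addr0 !mxE !mulr1.
exists (diag_sum b u); split.
  exists x.
    by apply/eqP => /rowP /(_ i0) /eqP; rewrite !mxE oner_eq0.
  apply/rowP => i; rewrite grad_diag_sum yu !mxE /=.
  case: ifP => _; last by rewrite mul0r expr0n d1' mul0r mulr0 addr0.
  rewrite mul1r mulr1 -exprSr prednK; last by lia.
  by rewrite beE addNr.
exists w; rewrite hess_diag_sum yu.
have -> : w 0 i0 + w 0 i1 = 0 by rewrite !mxE /= subrr.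
rewrite expr0n d2' scale0r addr0 unitmx_diag; apply/forallP => i.
rewrite !mxE; apply: mulf_neq0; apply: expf_neq0; first apply: mulf_neq0.
- by case: ifP; rewrite ?oppr_eq0 oner_eq0.
- by case: ifP; rewrite ?oner_eq0.
- by case: ifP; rewrite ?oner_eq0.
Qed.

(** * The possible numbers of singular points *)

Theorem theorem3p2 (R : realType) (d n : nat) (hd : (3 <= d)%N)
    (hn : (4 <= n)%N) :
  (* rank at most n - 2 *)
  ((forall f : {mpoly R[i][n]}, is_form d f -> has_rank_at_most d f (n - 2) ->
      infinite_set (singular_points f)) /\
   (exists f : {mpoly R[i][n]}, [/\ is_form d f, has_rank_at_most d f (n - 2) &
      infinite_set (singular_points f)])) /\
  (* rank n - 1 *)
  ((forall f : {mpoly R[i][n]}, is_form d f -> has_rank d f (n - 1) ->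
      singular_points f #= `I_1 \/ infinite_set (singular_points f)) /\
   (exists f : {mpoly R[i][n]}, [/\ is_form d f, has_rank d f (n - 1) &
      singular_points f #= `I_1]) /\
   (exists f : {mpoly R[i][n]}, [/\ is_form d f, has_rank d f (n - 1) &
      infinite_set (singular_points f)])) /\
  (* rank n *)
  ((forall f : {mpoly R[i][n]}, is_form d f -> has_rank d f n ->
      [\/ singular_points f #= `I_0, singular_points f #= `I_1 |
          infinite_set (singular_points f)]) /\
   (exists f : {mpoly R[i][n]}, [/\ is_form d f, has_rank d f n &
      singular_points f #= `I_0]) /\
   (exists f : {mpoly R[i][n]}, [/\ is_form d f, has_rank d f n &
      singular_points f #= `I_1]) /\
   (exists f : {mpoly R[i][n]}, [/\ is_form d f, has_rank d f n &
      infinite_set (singular_points f)])) /\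
  (forall (f : {mpoly R[i][n]}) (k : nat),
      is_form d f -> has_rank_at_most d f n -> (1 < k)%N ->
      ~ (singular_points f #= `I_k)).
Proof.
have d1 : (1 < d)%N by lia.
have d0 : (0 < d)%N by lia.
have sum_of_rank m (f : {mpoly R[i][n]}) :
    has_rank_at_most d f m -> sum_of_powers d m f.
  by case=> r rm [fr _]; apply: sum_of_powers_leq fr.
have few_powers r (f : {mpoly R[i][n]}) : (r <= n - 2)%N ->
    sum_of_powers d r f -> infinite_set (singular_points f).
  move=> rn /sum_of_powersP[L ->].
  by apply: infinite_singular_points_corank2 => //; lia.
have kernel_point r (f : {mpoly R[i][n]}) : (r <= n - 1)%N ->
    sum_of_powers d r f ->
    (exists p, singular_points f = [set p]) \/ infinite_set (singular_points f).
  move=> rn /sum_of_powersP[L ->].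
  have [|w w0 wL] := exists_ker L; first by lia.
  have [->|] := singular_points_of_ker w0 d1 wL; last by right.
  by left; exists (line_point w0).
have trichotomy (f : {mpoly R[i][n]}) : sum_of_powers d n f ->
    [\/ singular_points f #= `I_0, singular_points f #= `I_1 |
        infinite_set (singular_points f)].
  move=> /sum_of_powersP[L ->].
  have [->|[p ->]|] := singular_points_trichotomy L d1 (leqnn n).
  - by constructor 1; rewrite II0.
  - by constructor 2; apply: card_set1.
  - by constructor 3.
have form_of_not_sum r (f : {mpoly R[i][n]}) :
    sum_of_powers d r.+1 f -> ~ sum_of_powers d r f -> is_form d f.
  move=> fr nf; apply: (sum_of_powers_form d0 fr) => f0; apply: nf.
  exact: sum_of_powers_leq f0.
have smooth1 m (x : 'rV[R[i]]_m) : grad d 1%:M x = 0 -> x = 0.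
  by move/ker_of_grad_eq0; rewrite mxrank1 mulmx1 => /(_ erefl).
have singular_example m : (1 < m)%N -> (m < n)%N ->
    exists f : {mpoly R[i][n]},
      [/\ is_form d f, has_rank d f m.+1 & infinite_set (singular_points f)].
  move=> m1 mn.
  have [M [[x x0 gx] [w hw]]] := exists_singular_hess_unit R[i] m1 hd.
  pose f : {mpoly R[i][n]} := power_sum d (pid_mx m *m M).
  have fm : sum_of_powers d m.+1 f.
    by rewrite -addn1; apply: sum_of_powers_power_sum.
  have nf : ~ sum_of_powers d m f.
    exact: (not_sum_of_powers_singular d1 (ltnW mn) hw x0 gx).
  exists f; split; [exact: form_of_not_sum nf|exact: has_rankS|].
  exact: singular_points_singular_cone x0 gx.
have n1 : (n - 1).+1 = n by lia.
have n2 : (n - 2).+1 = (n - 1)%N by lia.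
split; [|split; [|split]].
- split=> [f _ /sum_of_rank|]; first exact: few_powers.
  have i0 : 'I_n by exists 0%N; lia.
  pose f : {mpoly R[i][n]} := 'X_i0 ^+ d.
  have f1 : sum_of_powers d 1 f.
    exists (fun=> 'X_i0).
    by split=> [_|]; rewrite ?big_ord1 // dhomogX /= mdeg1.
  have fn2 : sum_of_powers d (n - 2) f by apply: sum_of_powers_leq f1; lia.
  exists f; split; [|exact: has_rank_at_most_sum|exact: few_powers fn2].
  apply: form_of_not_sum f1 _ => -[l [_]]; rewrite big_ord0 => /eqP.
  rewrite expf_eq0 => /andP[_ /eqP/mpolyP/(_ U_(i0)%MM)/eqP].
  by rewrite mcoeffX eqxx mcoeff0 oner_eq0.
- split=> [f _ [fn1 _]|].
    have [[p ->]|] := kernel_point _ f (leqnn _) fn1; last by right.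
    by left; apply: card_set1.
  split; last by rewrite -n2; apply: singular_example; lia.
  have [p Sp] := singular_points_cone (esym n1) d1 (smooth1 _).
  set f := power_sum _ _ in Sp.
  have fn : sum_of_powers d (n - 2).+1 f.
    by rewrite n2; apply: sum_of_powers_power_sum.
  have nf : ~ sum_of_powers d (n - 2) f.
    by move/few_powers; rewrite Sp => /(_ (leqnn _)); apply; apply: finite_set1.
  exists f; split; first exact: form_of_not_sum nf.
    by rewrite -n2; apply: has_rankS.
  by rewrite Sp; apply: card_set1.
- split=> [f _ [fn _]|]; first exact: trichotomy.
  split; [|split]; last first.
  - by have := @singular_example (n - 1)%N; rewrite n1; apply; lia.
  - have n3 : (2 < n - 1)%N by lia.
    have [M [smooth nM]] := exists_smooth_not_sum_of_powers R[i] n3 hd.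
    have [p Sp] := singular_points_cone (esym n1) d1 smooth.
    set f := power_sum _ _ in Sp.
    have fn : sum_of_powers d (n - 1).+1 f.
      by rewrite -addn1; apply: sum_of_powers_power_sum.
    have nf : ~ sum_of_powers d (n - 1) f by apply: nM; lia.
    exists f; split; first exact: form_of_not_sum nf.
      by have := has_rankS d0 fn nf; rewrite n1.
    by rewrite Sp; apply: card_set1.
  - pose f : {mpoly R[i][n]} := power_sum d 1%:M.
    have Sf : singular_points f = set0.
      apply: singular_points_full_rank; rewrite ?mxrank1 // => v.
      by rewrite mulmx1.
    have fn : sum_of_powers d (n - 1).+1 f.
      by rewrite n1; apply: sum_of_powers_power_sum.
    have nf : ~ sum_of_powers d (n - 1) f.
      case/(kernel_point _ _ (leqnn _)) => [[p]|]; rewrite Sf; last exact.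
      by move/seteqP => [_ /(_ p)]; apply.
    exists f; split; first exact: form_of_not_sum nf.
      by have := has_rankS d0 fn nf; rewrite n1.
    by rewrite Sf II0.
- move=> f k _ /sum_of_rank/trichotomy fk k1 fIk.
  case: fk => [f0|f1|]; last by apply; exists k.
  + have : `I_0 #= `I_k by apply: card_eq_trans (card_esym f0) fIk.
    by move/card_eq_II => e; rewrite -e in k1.
  + have : `I_1 #= `I_k by apply: card_eq_trans (card_esym f1) fIk.
    by move/card_eq_II => e; rewrite -e in k1.
Qed.
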